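(* For every positive integer $k\le 3$ and every sequence $(t_n)_{n}$ of non-negative real numbers, $C_{\max}(G^k_{n,t_n})=o(n)$ in probability, i.e. $\frac{1}{n}C_{\max}(G^k_{n,t_n})\to 0$ in probability as $n\to\infty$.
   Context: Let $n,k$ be positive integers and let $E$ be the set of the $\binom n2$ unordered pairs of distinct elements of $\{1,\dots,n\}$. Let $(\Pi_e)_{e\in E}$ be independent Poisson point processes on $[0,\infty)$, each of intensity $\frac1n\,dt$. The forbidden-degree process $G^k_n=(G^k_{n,t})_{t\ge0}$ is the process of loopless multigraphs on the vertex set $\{1,\dots,n\}$ defined as follows: $G^k_{n,0}$ has no edge; at each time $t\in\Pi_e$ the multiplicity of the edge $e$ is increased by $1$ and then, for any endpoint $w$ of $e$ whose degree (counted with multiplicity) reaches $k$ at this step, all edges incident to $w$, including $e$, are removed (if both endpoints reach degree $k$ simultaneously, the removal takes place at both). Removed edges may be added again later. $C_{\max}(G)$ denotes the number of vertices of the largest connected component of $G$. *)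

(* Defs.v *)
From HB Require Import structures.
From mathcomp Require Export all_boot all_order all_algebra.
From mathcomp Require Export finmap.
From mathcomp Require Export all_classical all_reals all_analysis.
Set Implicit Arguments.
Unset Strict Implicit.
Unset Printing Implicit Defensive.
Import Order.TTheory GRing.Theory Num.Theory.
Import numFieldNormedType.Exports.
Local Open Scope classical_set_scope.
Local Open Scope ring_scope.

Definition edge (n : nat) := {e : {set 'I_n} | #|e| == 2%N}.

(* A loopless multigraph is the function giving the multiplicity of each
   unordered pair of distinct vertices. *)
Definition multigraph (n : nat) := {ffun edge n -> nat}.

Definition empty_graph (n : nat) : multigraph n := [ffun=> 0%N].

Definition degree (n : nat) (G : multigraph n) (w : 'I_n) : nat :=
  (\sum_(e : edge n | w \in val e) G e)%N.

Definition adjacent (n : nat) (G : multigraph n) : rel 'I_n :=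
  fun u v => [exists e : edge n, (0 < G e)%N && (val e == [set u; v]%SET)].

Definition Cmax (n : nat) (G : multigraph n) : nat :=
  (\max_(v : 'I_n) #|connect (adjacent G) v|)%N.

Definition add_edge (n : nat) (G : multigraph n) (e : edge n) : multigraph n :=
  [ffun f : edge n => (G f + (f == e))%N].

(* Both endpoints are tested in the graph preceding any removal, so that a
   simultaneous hit of degree k triggers the removal at both. *)
Definition update (n k : nat) (G : multigraph n) (e : edge n) : multigraph n :=
  let G' := add_edge G e in
  [ffun f : edge n =>
     if [exists w, [&& w \in val e, w \in val f & degree G' w == k]]
     then 0%N else G' f].

Section process.
Context {R : realType}.

(* The tie-breaking by [enum_rank] only concerns simultaneous points of two
   distinct edges, which almost surely do not exist; it keeps the sorted list
   a deterministic (and measurable) function of the points. *)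
Definition earlier (n : nat) (x y : R * edge n) : bool :=
  (x.1 < y.1) || ((x.1 == y.1) && (enum_rank x.2 <= enum_rank y.2)%N).

(* The points of the sets [pi e] in ]0, t], each one together with its edge, in
   increasing order of time. *)
Definition arrivals (n : nat) (pi : edge n -> set R) (t : R) :
    seq (R * edge n) :=
  sort (@earlier n)
    (fset_set [set x : R * edge n | 0 < x.1 <= t /\ pi x.2 x.1]).

Definition forbidden_degree_process (n k : nat) (pi : edge n -> set R)
    (t : R) : multigraph n :=
  foldl (fun G x => update k G x.2) (empty_graph n) (arrivals pi t).

End process.

Section probability.
Context {R : realType} (d : measure_display) (T : measurableType d).
Variable P : probability T R.

Definition mutually_independent (I : finType) (F : I -> set (set T)) : Prop :=
  forall (J : {set I}) (A : I -> set T),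
    (forall i, i \in J -> F i (A i)) ->
    P (\bigcap_(i in [set` J]) A i) = (\prod_(i in J) P (A i))%E.

(* The event that the random set X has exactly m points in B. *)
Definition count_event (X : T -> set R) (B : set R) (m : nat) : set T :=
  [set w | (X w `&` B #= `I_m)%card].

(* A simple point process: a random locally finite subset of [0, +oo[. *)
Definition point_process (X : T -> set R) : Prop :=
  [/\ forall w, X w `<=` `[0, +oo[,
      forall w a, finite_set (X w `&` `[0, a]) &
      forall (B : set R) (m : nat), measurable B -> measurable (count_event X B m)].

Definition sigma_of (X : T -> set R) : set (set T) :=
  <<s [set S | exists (B : set R) (m : nat), measurable B /\ S = count_event X B m] >>.

(* Not [poisson_pmf], whose value at rate 0 is 1 for every m. *)
Definition poisson_weight (r : R) (m : nat) : R :=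
  expR (- r) * r ^+ m / m`!%:R.

(* Poisson point process on [0, +oo[ of intensity lambda dt. *)
Definition poisson_point_process (lambda : R) (X : T -> set R) : Prop :=
  [/\ point_process X,
      forall (B : set R) (m : nat), measurable B -> B `<=` `[0, +oo[ ->
        (lebesgue_measure B < +oo)%E ->
        P (count_event X B m) =
          (poisson_weight (lambda * fine (lebesgue_measure B)) m)%:E &
      forall (l : nat) (B : 'I_l -> set R),
        (forall i, measurable (B i)) -> (forall i, B i `<=` `[0, +oo[) ->
        (forall i, lebesgue_measure (B i) < +oo)%E ->
        trivIset setT B ->
        mutually_independent
          (fun i => [set count_event X (B i) m | m in [set: nat]])].

End probability.

Definition cvg_in_probability {R : realType} (d : nat -> measure_display)
    (T : forall n, measurableType (d n)) (P : forall n, probability (T n) R)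
    (X : forall n, T n -> R) (c : R) : Prop :=
  forall eps : R, 0 < eps ->
    (fun n => P n [set w | eps <= `|X n w - c|]) @ \oo --> 0%E.

(* Main.v *)
(* Let [S] be the number of ordered pairs of connected vertices, so that
   [Cmax ^ 2 <= S]. All degrees stay at most 2, hence a component has at most two
   unsaturated vertices (those of degree less than [k - 1]). An arrival joining
   two unsaturated vertices creates at most twice the product of their component
   sizes, while an arrival at a saturated vertex isolates it. Thus the sum over
   the edges of the increments of [S] is at most [7 n^2 - (n - 1) S], and the mean
   of [S] remains at most [15 n] at all times; Markov's inequality then bounds
   [P (Cmax >= eps n)] by [15 / (eps^2 n)].

   The time interval ]0, t] is cut into [r] slots, and each edge is applied once
   in every slot where it has a point. For a given configuration this yields the
   process itself as soon as [r] is large, which gives the measurability of the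
   events on [Cmax] and reduces the drift argument to independent coin flips. *)
Require Import Defs.
From mathcomp Require Import zify ring lra.
Import Order.TTheory GRing.Theory Num.Theory.
Import numFieldNormedType.Exports.
Local Open Scope classical_set_scope.
Local Open Scope ring_scope.
Set Implicit Arguments.
Unset Strict Implicit.
Unset Printing Implicit Defensive.

(** * Components and the drift of the number of connected pairs *)

Section Graph.
Local Open Scope nat_scope.
Variable n : nat.
Implicit Types (G H : multigraph n) (e f : edge n) (u v w : 'I_n) (A : {set 'I_n}).

Definition component G v : {set 'I_n} := [set u | connect (adjacent G) v u]%SET.

Definition pairs_connected G : nat := \sum_v #|component G v|.

Lemma adjacent_sym G : symmetric (adjacent G).
Proof. by move=> u v; rewrite /adjacent; apply: eq_existsb => e; rewrite finset.setUC. Qed.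

Lemma connect_adjacent_sym G : connect_sym (adjacent G).
Proof. exact/sym_connect_sym/adjacent_sym. Qed.

Lemma in_component G u v : (u \in component G v) = connect (adjacent G) v u.
Proof. by rewrite inE. Qed.

Lemma component_refl G v : v \in component G v.
Proof. by rewrite inE connect0. Qed.

Lemma component_sym G u v : (u \in component G v) = (v \in component G u).
Proof. by rewrite !inE connect_adjacent_sym. Qed.

Lemma component_eq G u v : u \in component G v -> component G u = component G v.
Proof.
rewrite inE => uv; apply/finset.setP => w; rewrite !inE.
by rewrite (same_connect (@connect_adjacent_sym G) uv).
Qed.

Lemma card_component_connect G v : #|component G v| = #|connect (adjacent G) v|.
Proof. by apply: eq_card => u; rewrite inE. Qed.

(** Each vertex of a largest component contributes the size of that component to the sum. *)
Lemma Cmax_sqr_le G : Cmax G ^ 2 <= pairs_connected G.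
Proof.
have [v0|v0] := posnP n.
  rewrite /Cmax big1 // => -[i i_lt]; exfalso; by rewrite v0 in i_lt.
rewrite /Cmax; have [|v ->] := @bigop.eq_bigmax _ (fun v : 'I_n => #|connect (adjacent G) v|).
  by rewrite card_ord.
rewrite -card_component_connect /pairs_connected.
rewrite (bigID (mem (component G v))) /=; apply: leq_trans (leq_addr _ _).
rewrite (eq_bigr (fun=> #|component G v|)); last first.
  by move=> u uv; rewrite (component_eq uv).
by rewrite sum_nat_const mulnn.
Qed.

Lemma edge_eq e u v : u != v -> u \in val e -> v \in val e -> val e = [set u; v]%SET.
Proof.
move=> uv ue ve; apply/esym/eqP; rewrite eqEcard.
rewrite (eqP (valP e)) cards2 uv leqnn andbT.
by apply/fintype.subsetP => w /set2P[] ->.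
Qed.

Lemma card_edges_at w : #|[pred e : edge n | w \in val e]| = n.-1.
Proof.
pose P2 (A : {set 'I_n}) := #|A| == 2.
pose f v : option (edge n) := insub [set w; v]%SET.
have cardv v : v != w -> #|[set w; v]%SET| == 2 by rewrite cards2 eq_sym => ->.
have -> : n.-1 = #|[set~ w]%SET| by rewrite cardsC1 card_ord.
rewrite -(card_in_imset (f := f) (D := [set~ w]%SET)); last first.
  move=> u v; rewrite !inE => uw vw; rewrite /f (insubT P2 (cardv u uw)) (insubT P2 (cardv v vw)).
  move=> /Some_inj/(congr1 val); rewrite !SubK => /finset.setP/(_ u).
  by rewrite !inE eqxx orbT (negPf uw) /= => /esym/eqP.
have sI : injective (@Some (edge n)) by move=> ? ? [].
rewrite -(card_imset _ sI).
apply: eq_card => x; apply/imsetP/imsetP => -[].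
  move=> e; rewrite inE => we -> {x}.
  have : #|val e :\ w| == 1 by have := cardsD1 w (val e); rewrite we (eqP (valP e)) => /eqP; rewrite add1n eqSS eq_sym.
  case/cards1P => v ev; have : v \in val e :\ w by rewrite ev inE.
  rewrite !inE => /andP[vw ve]; exists v; rewrite ?inE //.
  rewrite /f -(edge_eq _ we ve) 1?eq_sym //; exact/esym/valK.
move=> v; rewrite !inE => vw ->; exists (Sub [set w; v]%SET (cardv _ vw)).
  by rewrite inE SubK !inE eqxx.
by rewrite /f (insubT P2 (cardv v vw)).
Qed.

Lemma edges_at_two u v : u != v ->
  #|[pred e : edge n | (u \in val e) && (v \in val e)]| <= 1.
Proof.
move=> uv; apply/card_le1P => e; rewrite inE => /andP[ue ve] f.
rewrite !inE; apply/idP/eqP => [/andP[uf vf]|->]; last by rewrite ue ve.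
by apply/val_inj; rewrite (edge_eq uv ue ve) (edge_eq uv uf vf).
Qed.

Definition inner_edges G A : nat := \sum_(e : edge n | val e \subset A) G e.

(** Take [A] maximal among the subsets of the component that contain [v] and satisfy the bound. If
    an edge left [A], adding its far end would cost one vertex and bring at least one inner edge; so
    [A] is the whole component. *)
Lemma card_component_le G v :
  #|component G v| <= (inner_edges G (component G v)).+1.
Proof.
pose C := component G v.
pose Q := [pred A : {set 'I_n} | [&& v \in A, A \subset C & #|A| <= (inner_edges G A).+1]].
have Qv : Q [set v]%SET.
  by rewrite /Q /= inE eqxx finset.sub1set component_refl cards1.
have [A /maxsetP[/and3P[vA AC cA] Amax] _] := maxset_exists Qv.
rewrite -/C; suff -> : C = A by [].
apply/eqP; rewrite finset.eqEsubset AC andbT; apply/negPn/negP => nCA.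
suff [u [w [uA wA wC]]] : exists u, exists w,
    [/\ u \in A, w \notin A & adjacent G u w].
  have /existsP[e /andP[e0 /eqP ee]] := wC.
  suff /Amax: Q (w |: A).
    by move=> /(_ (finset.subsetUr _ _)) wAA; move: wA; rewrite -wAA setU11.
  apply/and3P; split; first by rewrite inE vA orbT.
    rewrite finset.subUset AC andbT finset.sub1set.
    have uC : u \in C by exact: (fintype.subsetP AC).
    rewrite /C in_component in uC; rewrite /C in_component.
    exact: connect_trans uC (connect1 wC).
  rewrite cardsU1 wA add1n ltnS (leq_trans cA) //.
  rewrite /inner_edges [ltnRHS](bigD1 e) /=; last first.
    by rewrite ee finset.subUset !finset.sub1set setU11 inE uA orbT.
  rewrite -add1n leq_add //.
  rewrite [leqRHS]big_mkcond [leqLHS]big_mkcond /=; apply: leq_sum => f _.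
  case: ifP => // fA; rewrite (fintype.subset_trans fA (finset.subsetUr _ _)) /=.
  case: eqP => // fe; move: wA.
  by rewrite (fintype.subsetP fA) // fe ee !inE eqxx orbT.
(* A path from [v] to a vertex outside [A] has a first step that leaves [A]. *)
case/subsetPn: nCA => x; rewrite in_component => /connectP[p pth ->] {x}.
elim: p v vA pth {C Q Qv AC cA Amax} => [v -> //|w p IH v vA /= /andP[vw wp] last].
have [wA|wA] := boolP (w \in A); first exact: (IH w).
by exists v, w.
Qed.

(** An edge inside [A] is counted once from each of its two ends. *)
Lemma sum_degree_ge_inner G A : 2 * inner_edges G A <= \sum_(w in A) degree G w.
Proof.
rewrite /degree (exchange_big_dep xpredT) //= /inner_edges.
rewrite big_distrr /= [leqLHS]big_mkcond; apply: leq_sum => e _.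
case: ifP => // eA; rewrite sum_nat_const.
rewrite leq_mul2r; apply/orP; right.
rewrite -[leqLHS](eqP (valP e)); apply: subset_leq_card; apply/fintype.subsetP => x xe.
by apply/andP; split => //; apply: (fintype.subsetP eA).
Qed.

(** In a component of [m] vertices the degree sum is at least [2 (m - 1)], and it is at most [2 m]
    minus the number of vertices of degree at most 1. *)
Lemma card_low_degree_component G v : (forall w, degree G w <= 2) ->
  #|[set w in component G v | degree G w <= 1]%SET| <= 2.
Proof.
move=> deg2; set C := component G v.
have h1 := card_component_le G v; have h2 := sum_degree_ge_inner G C.
have h3 : \sum_(w in C) degree G w + #|[set w in C | degree G w <= 1]%SET| <= \sum_(w in C) 2.
  rewrite -sum1dep_card big_mkcondr -big_split /=; apply: leq_sum => w _.
  by case: ifP => // h; have := deg2 w; lia.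
rewrite sum_nat_const in h3; rewrite -/C in h1; lia.
Qed.

Lemma degree_add_edge G e w : degree (add_edge G e) w = degree G w + (w \in val e).
Proof.
rewrite /degree.
under eq_bigr do rewrite ffunE.
rewrite big_split /=; congr addn.
case: (boolP (w \in val e)) => we.
  rewrite (bigD1 e) //= eqxx big1 // => f /andP[_ /negPf ->] //.
by rewrite big1 // => f wf; case: eqP => // fe; rewrite fe (negPf we) in wf.
Qed.

Lemma degree_empty w : degree (empty_graph n) w = 0.
Proof. by rewrite /degree big1 // => e _; rewrite ffunE. Qed.

(** * Effect of one arrival on the components *)

Variable k : nat.
Hypothesis hk : 0 < k <= 3.

Definition subcritical G := [forall w, degree G w < k].

Lemma subcritical_empty : subcritical (empty_graph n).
Proof. by apply/forallP => w; rewrite degree_empty; case/andP: hk. Qed.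

(** A vertex that reaches degree [k] loses all its edges; at the others the removals only lower a
    degree that is already below [k]. *)
Lemma subcritical_update G e : subcritical G -> subcritical (update k G e).
Proof.
move=> /forallP sG; apply/forallP => w.
have := degree_add_edge G e w; set G' := add_edge G e => dG'.
have [dk|dk] := eqVneq (degree G' w) k.
  rewrite {1}/degree big1 ?(andP hk).1 // => f wf; rewrite ffunE ifT //.
  apply/existsP; exists w; rewrite wf dk eqxx !andbT.
  by case: (w \in val e) dG' => //; have := sG w; lia.
apply: (@leq_ltn_trans (degree G' w)).
  by apply: leq_sum => f _; rewrite ffunE; case: ifP.
by rewrite ltn_neqAle dk dG'; have := sG w; case: (w \in val e); lia.
Qed.

(** One more edge at such a vertex brings it to degree [k] and thereby isolates it. *)
Definition saturated G w := degree G w == k.-1.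

(** The bound [k <= 3] enters here: all degrees are at most 2, and an unsaturated vertex has degree
    at most [k - 2 <= 1]. *)
Lemma card_unsaturated_component G v : subcritical G ->
  #|[set w in component G v | ~~ saturated G w]%SET| <= 2.
Proof.
move=> /forallP sG.
apply: leq_trans (@card_low_degree_component G v _); last first.
  by move=> w; have := sG w; lia.
apply/subset_leq_card/fintype.subsetP => w; rewrite !inE => /andP[-> /=].
by rewrite /saturated; have := sG w; lia.
Qed.

(** Double counting: a vertex lies in the components of at most two unsaturated vertices, namely
    those of its own component. *)
Lemma sum_component_unsaturated G : subcritical G ->
  \sum_(w | ~~ saturated G w) #|component G w| <= 2 * n.
Proof.
move=> sG.
under eq_bigr do rewrite -sum1_card.
rewrite (exchange_big_dep xpredT) //=.
apply: (@leq_trans (\sum_(v : 'I_n) 2)); last by rewrite sum_nat_const card_ord mulnC.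
apply: leq_sum => v _; rewrite sum1_card.
apply: leq_trans (card_unsaturated_component v sG).
apply/subset_leq_card/fintype.subsetP => w; rewrite unfold_in => /andP[sw vw].
by rewrite inE sw component_sym vw.
Qed.

Lemma connect_sub_graph G H : (forall e, 0 < H e -> 0 < G e) ->
  forall v, component H v \subset component G v.
Proof.
move=> HG v; apply/fintype.subsetP => u; rewrite !inE; apply: connect_sub => x y.
case/existsP => e /andP[/HG Ge /eqP ee]; apply/connect1/existsP; exists e.
by rewrite Ge ee eqxx.
Qed.

Lemma component_isolated G v : degree G v = 0 -> component G v = [set v]%SET.
Proof.
move=> d0; apply/eqP; rewrite finset.eqEsubset finset.sub1set component_refl andbT.
apply/fintype.subsetP => u; rewrite in_component => /connectP[[|w p] /=]; first by move=> _ ->; rewrite inE.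
case/andP => /existsP[e /andP[e0 /eqP ee]] _ _; exfalso.
move: d0 => /eqP; rewrite /degree (bigD1 e) /=; last by rewrite ee setU11.
by rewrite addn_eq0 => /andP[/eqP e00]; rewrite e00 in e0.
Qed.

(** Crossing the new edge back and forth returns to the component of departure, so a path reduces to
    at most one crossing, in one of the two directions. *)
Lemma component_add_edge G e a b v u : val e = [set a; b]%SET ->
  u \in component (add_edge G e) v ->
  [\/ u \in component G v,
      a \in component G v /\ u \in component G b |
      b \in component G v /\ u \in component G a].
Proof.
move=> eab; rewrite in_component => /connectP[p pth ->] {u}.
elim: p v pth => [v _|w p IH v /= /andP[vw /IH {IH}]].
  by apply: Or31; exact: component_refl.
set z := last w p; move: z => z {p}.
have {vw} : w \in component G v \/ (v = a /\ w = b) \/ (v = b /\ w = a).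
  case/existsP: vw => f; rewrite ffunE; have [->|fe] := eqVneq f e.
    rewrite eab => /andP[_ /eqP vw]; right.
    have av : v \in [set a; b]%SET by rewrite vw setU11.
    have aw : w \in [set a; b]%SET by rewrite vw !inE eqxx orbT.
    have bv : a \in [set v; w]%SET by rewrite -vw setU11.
    have bw : b \in [set v; w]%SET by rewrite -vw !inE eqxx orbT.
    case/set2P: av => ?; case/set2P: aw => ?; subst; auto.
      by case/set2P: bw => ?; subst; auto.
    by case/set2P: bv => ?; subst; auto.
  rewrite addn0 => h; left; rewrite in_component; apply/connect1/existsP; exists f; exact: h.
case=> [/component_eq -> //|[[-> ->]|[-> ->]]] [h|[h1 h2]|[h1 h2]].
- by apply: Or32; rewrite component_refl.
- by apply: Or32; rewrite component_refl.
- exact: Or31.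
- by apply: Or33; rewrite component_refl.
- exact: Or31.
- by apply: Or33; rewrite component_refl.
Qed.

(** Since [w] reaches degree [k], the new copy of [e] is removed at once, and no multiplicity
    grows. *)
Lemma update_saturatedE G e w : w \in val e -> saturated G w ->
  forall f, update k G e f <= G f.
Proof.
move=> we sw f; rewrite ffunE; case: ifP => // /negbT/existsPn/(_ w).
rewrite we degree_add_edge we addn1 (eqP sw) prednK ?eqxx ?andbT; last by case/andP: hk.
by move=> wf; rewrite ffunE; case: eqP wf => [->|]; rewrite ?we ?addn0.
Qed.

Lemma component_update_saturated G e v : [exists w in val e, saturated G w] ->
  component (update k G e) v \subset component G v.
Proof.
case/existsP => w /andP[we sw]; apply: connect_sub_graph => f f0.
exact: leq_trans f0 (update_saturatedE we sw f).
Qed.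

Lemma saturated_isolated G e w : w \in val e -> saturated G w ->
  component (update k G e) w = [set w]%SET.
Proof.
move=> we sw; apply: component_isolated; rewrite /degree big1 // => f wf.
rewrite ffunE ifT //; apply/existsP; exists w.
by rewrite we wf degree_add_edge we addn1 (eqP sw) prednK ?eqxx //; case/andP: hk.
Qed.

Lemma update_unsaturatedE G e : subcritical G -> ~~ [exists w in val e, saturated G w] ->
  update k G e = add_edge G e.
Proof.
move=> /forallP sG /existsPn ns; apply/ffunP => f; rewrite ffunE ifF //.
apply/negbTE/existsPn => w; rewrite negb_and negb_and -implybE.
apply/implyP => we; apply/orP; right; rewrite degree_add_edge we.
have := ns w; rewrite we /= /saturated; have := sG w; lia.
Qed.

(** Twice the product of the two component sizes if both ends of [e] are unsaturated, and 0
    otherwise. Written over ordered pairs of vertices, it can be exchanged with a sum over [e]. *)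
Definition gain G e := \sum_(a | ~~ saturated G a) \sum_(b | ~~ saturated G b)
  ([&& a != b, a \in val e & b \in val e] * (#|component G a| * #|component G b|)).

Lemma pairs_connected_update_unsaturated G e :
  subcritical G -> ~~ [exists w in val e, saturated G w] ->
  pairs_connected (update k G e) <= pairs_connected G + gain G e.
Proof.
move=> sG ns; rewrite (update_unsaturatedE sG ns).
have /cards2P[a [b [ab eab]]] : #|val e| == 2 := valP e.
have ae : a \in val e by rewrite eab setU11.
have be : b \in val e by rewrite eab !inE eqxx orbT.
have nsat w : w \in val e -> ~~ saturated G w.
  by move=> we; move/existsPn/(_ w): ns; rewrite we.
have h1 : #|component G a| * #|component G b| + #|component G b| * #|component G a| <= gain G e.
  rewrite /gain (bigD1 a) ?nsat //= (bigD1 b) ?nsat //= ab ae be mul1n -addnA leq_add2l.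
  apply: leq_trans (leq_addl _ _); rewrite (bigD1 b) ?nsat 1?eq_sym ?ab //=.
  by rewrite (bigD1 a) ?nsat //= eq_sym ab ae be mul1n -addnA leq_addr.
apply: leq_trans (leq_add (leqnn (pairs_connected G)) h1).
rewrite -(sum_nat_const (mem (component G a))) -(sum_nat_const (mem (component G b))).
rewrite /pairs_connected [X in _ <= _ + (X + _)]big_mkcond [X in _ <= _ + (_ + X)]big_mkcond.
rewrite -!big_split /=; apply: leq_sum => v _.
set X := component _ v.
(* The component of [v] grows only if it contains an end of [e], and then by at most the component
   of the other end. *)
apply: (@leq_trans #|component G v :|: ((if a \in component G v then component G b else finset.set0)
    :|: (if b \in component G v then component G a else finset.set0))|).
  apply/subset_leq_card/fintype.subsetP => u /(component_add_edge eab).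
  by case=> [h|[h1' h2]|[h1' h2]]; rewrite !finset.in_setU ?h ?h1' ?h2 ?orbT.
apply: leq_trans (leq_card_setU _ _) _; rewrite leq_add2l.
apply: leq_trans (leq_card_setU _ _) _; apply: leq_add.
  by rewrite (component_sym G v a); case: ifP => _; rewrite ?cards0.
by rewrite (component_sym G v b); case: ifP => _; rewrite ?cards0.
Qed.

Lemma pairs_connected_update_saturated G e :
  [exists w in val e, saturated G w] ->
  pairs_connected (update k G e)
    + \sum_(w | saturated G w) (w \in val e) * #|component G w|
  <= pairs_connected G + \sum_(w | saturated G w) (w \in val e).
Proof.
move=> ns; rewrite /pairs_connected [X in _ + X <= _]big_mkcond [X in _ <= _ + X]big_mkcond -!big_split /=.
apply: leq_sum => w _.
have cw : #|component (update k G e) w| <= #|component G w|.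
  exact/subset_leq_card/component_update_saturated.
case: ifP => [sw|]; last by rewrite !addn0.
case: (boolP (w \in val e)) => we; last by rewrite mul0n !addn0.
by rewrite (saturated_isolated we sw) cards1 mul1n addnC.
Qed.

(** The loss stands on the left to avoid subtraction in [nat]. Arrivals without a saturated endpoint
    are accounted for by [gain], the others by the two sums over saturated vertices. *)
Lemma pairs_connected_update G e : subcritical G ->
  pairs_connected (update k G e)
    + \sum_(w | saturated G w) (w \in val e) * #|component G w|
  <= pairs_connected G + \sum_(w | saturated G w) (w \in val e) + gain G e.
Proof.
move=> sG; have [ns|ns] := boolP [exists w in val e, saturated G w].
  exact: leq_trans (pairs_connected_update_saturated ns) (leq_addr _ _).
have z (F : 'I_n -> nat) : \sum_(w | saturated G w) (w \in val e) * F w = 0.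
  by apply: big1 => w sw; move/existsPn/(_ w): ns; rewrite sw andbT => /negPf ->.
rewrite z addn0; apply: leq_trans (pairs_connected_update_unsaturated sG ns) _.
by rewrite -addnA leq_add2l leq_addl.
Qed.

(** Two distinct vertices span at most one edge, so the total is at most the square of the sum in
    [sum_component_unsaturated]. *)
Lemma sum_gain G : subcritical G -> \sum_(e : edge n) gain G e <= 4 * n ^ 2.
Proof.
move=> sG; rewrite /gain exchange_big /=.
apply: (@leq_trans ((\sum_(w | ~~ saturated G w) #|component G w|) ^ 2)); last first.
  by have := sum_component_unsaturated sG; rewrite -(leq_sqr _ (2 * n)) expnMn.
rewrite -mulnn big_distrl /=; apply: leq_sum => a _.
rewrite big_distrr exchange_big /=; apply: leq_sum => b _.
rewrite -big_distrl /= -[leqRHS]mul1n leq_mul2r; apply/orP; right.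
have [_|ab] := eqVneq a b; first by rewrite big1.
rewrite /= -big_mkcond sum1_card; exact: edges_at_two.
Qed.

(* An arrival isolates its saturated endpoints, and a component has at most two
   unsaturated vertices: the loss is at least [(n - 1) (pairs_connected G - 3 n)]
   while the gain is at most [(2 n)^2]. *)
Lemma drift_pairs_connected G : subcritical G ->
  \sum_(e : edge n) pairs_connected (update k G e) + n.-1 * pairs_connected G
  <= #|{: edge n}| * pairs_connected G + 7 * n ^ 2.
Proof.
move=> sG.
have := @leq_sum _ (index_enum (edge n)) xpredT _ _ (fun e _ => pairs_connected_update e sG).
rewrite !big_split /= sum_nat_const; have := sum_gain sG.
have -> : \sum_(e : edge n) \sum_(w | saturated G w) (w \in val e) * #|component G w| =
   n.-1 * \sum_(w | saturated G w) #|component G w|.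
  rewrite exchange_big big_distrr /=; apply: eq_bigr => w _.
  by rewrite -big_distrl /= -big_mkcond sum1_card card_edges_at.
have : \sum_(e : edge n) \sum_(w | saturated G w) (w \in val e) <= n.-1 * n.
  rewrite exchange_big /=.
  under eq_bigr do rewrite -big_mkcond sum1_card card_edges_at.
  by rewrite sum_nat_const mulnC leq_mul2l -[leqRHS](card_ord n) max_card orbT.
have := sum_component_unsaturated sG.
have : pairs_connected G = \sum_(w | saturated G w) #|component G w| + \sum_(w | ~~ saturated G w) #|component G w|.
  by rewrite /pairs_connected (bigID (saturated G)).
set S := pairs_connected G; set s1 := \sum_(w | saturated G w) _; set s2 := \sum_(w | ~~ _) _.
set x1 := \sum_(e : edge n) \sum_(w | _) _; set x2 := \sum_(e : edge n) gain _ _.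
set x3 := \sum_(e : edge n) _; set x4 := #|{: edge n}| * _.
move: S s1 s2 x1 x2 x3 x4 => S s1 s2 x1 x2 x3 x4 -> h2 h1 hg.
(* The constant 7 collects 4 from [sum_gain], 2 from the unsaturated part [s2] of the pairs and 1
   from the vertices left isolated. *)
have : n.-1 * s2 <= n.-1 * (2 * n) by rewrite leq_mul2l h2 orbT.
have : n.-1 * n <= n ^ 2 by rewrite -mulnn leq_mul2r leq_pred orbT.
rewrite mulnDr mulnCA; lia.
Qed.

End Graph.

(** * Chains whose moves are performed with a small probability *)

Section LazyChain.
Context {R : realType} {E S : Type}.
Variables (act : S -> E -> S) (p : R).
Hypothesis p01 : 0 <= p <= 1.
Implicit Types (s : seq E) (h : S -> R) (x : S).

(* The mean of [h] after the moves [s] from [x], each of which is performed with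
   probability [p], independently of the others. *)
Fixpoint lazy_mean s h x : R :=
  if s is e :: s' then (1 - p) * lazy_mean s' h x + p * lazy_mean s' h (act x e)
  else h x.

Lemma lazy_mean_cat s1 s2 h x :
  lazy_mean (s1 ++ s2) h x = lazy_mean s1 (lazy_mean s2 h) x.
Proof. by elim: s1 x => //= e s1 IH x; rewrite !IH. Qed.

Lemma lazy_mean_affine s h (a b : R) x :
  lazy_mean s (fun y => a * h y + b) x = a * lazy_mean s h x + b.
Proof. by elim: s x => //= e s IH x; rewrite !IH; ring. Qed.

Lemma le_lazy_mean (Q : pred S) s h h' x :
  (forall y e, Q y -> Q (act y e)) -> (forall y, Q y -> h y <= h' y) ->
  Q x -> lazy_mean s h x <= lazy_mean s h' x.
Proof.
case/andP: p01 => p0 p1 Qact hh; elim: s x => [x /hh //|e s IH x Qx /=].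
by apply: lerD; apply: ler_wpM2l; rewrite ?subr_ge0 ?IH ?Qact.
Qed.

(** Some move is performed with probability at most [size s * p], and [h] varies by at most [M]. *)
Lemma lazy_mean_first_order s h (M : R) x : (forall y, 0 <= h y <= M) ->
  `|lazy_mean s h x - h x| <= (size s)%:R * p * M.
Proof.
case/andP: p01 => p0 p1 hM.
have M0 : 0 <= M by have /andP[] := hM x; apply: le_trans.
have bnd s' y : 0 <= lazy_mean s' h y <= M.
  elim: s' y => [//|e s' IH y /=].
  by have /andP[? ?] := IH y; have /andP[? ?] := IH (act y e); apply/andP; split; nra.
elim: s => [|e s IH]; first by rewrite subrr normr0 !mul0r.
rewrite [lazy_mean _ _ _]/= -natr1.
have /andP[a0 aM] := bnd s x; have /andP[b0 bM] := bnd s (act x e).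
have /andP[c0 cM] := hM x.
move: IH; rewrite !ler_norml => /andP[u v].
by apply/andP; split; nra.
Qed.

(** To first order in [p] at most one move is performed, which gives the sum over single moves; two
    or more moves cost a term quadratic in [size s * p]. *)
Lemma lazy_mean_second_order s h (M : R) x : (forall y, 0 <= h y <= M) ->
  lazy_mean s h x <=
    h x + p * \sum_(e <- s) (h (act x e) - h x) + ((size s)%:R * p) ^+ 2 * M.
Proof.
case/andP: p01 => p0 p1 hM.
have M0 : 0 <= M by have /andP[] := hM x; apply: le_trans.
elim: s => [|e s IH]; first by rewrite big_nil /= !mul0r expr2 !mul0r; lra.
rewrite big_cons [size _]/= -natr1.
have := lazy_mean_first_order s x hM.
have := lazy_mean_first_order s (act x e) hM.
rewrite /= !ler_norml => /andP[u1 v1] /andP[u2 v2].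
set L := lazy_mean s h x in IH u2 v2 *.
set L' := lazy_mean s h (act x e) in u1 v1 *.
set N : R := (size s)%:R in IH u1 v1 u2 v2 *.
have N0 : 0 <= N by rewrite /N ler0n.
(* The first-order bounds replace both means by values of [h]. After the factor [p] the error
   [2 N p^2 M] fits into the growth of [(N p)^2 M] when [N] becomes [N + 1]. *)
have : p * (L' - L) <= p * (h (act x e) - h x + 2 * (N * p * M)).
  by apply: ler_wpM2l => //; lra.
have : 0 <= p ^+ 2 * M by rewrite mulr_ge0 ?sqr_ge0.
move: IH; rewrite !expr2; set T := \sum_(_ <- _) _.
nra.
Qed.

End LazyChain.

(** * Contraction of the mean number of connected pairs under sweeps over all edges *)

Section PairsMean.
Context {R : realType}.
Variables (n k : nat).
Hypotheses (n2 : (2 <= n)%N) (hk : (0 < k <= 3)%N).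

Let S (G : multigraph n) : R := (pairs_connected G)%:R.
Let N := #|{: edge n}|.

Lemma pairs_connected_bound (G : multigraph n) : 0 <= S G <= n%:R ^+ 2.
Proof.
rewrite ler0n -natrX ler_nat /pairs_connected -mulnn /=.
rewrite -[X in (X * _)%N]card_ord -sum_nat_const; apply: leq_sum => v _.
by rewrite -[leqRHS](card_ord n) max_card.
Qed.

Lemma pairs_connected_empty : pairs_connected (empty_graph n) = n.
Proof.
rewrite /pairs_connected -[RHS]card_ord -sum1_card; apply: eq_bigr => v _.
by rewrite component_isolated ?cards1 // degree_empty.
Qed.

Variable p : R.
Hypotheses (p0 : 0 <= p) (pn : p * n%:R <= 2) (pN : p * N%:R ^+ 2 <= 2^-1) (p1 : p <= 1).

(** The second-order expansion turns the drift bound into a contraction towards [15 n]. By [pN] its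
    quadratic error is at most [p n^2 / 2], whence [15 = 2 (7 + 1/2)]. *)
Lemma sweep_pairs_connected (G : multigraph n) : subcritical k G ->
  lazy_mean (update k) p (enum {: edge n}) S G - 15 * n%:R <=
    (1 - p * n%:R / 2) * (S G - 15 * n%:R).
Proof.
move=> sG; have p01 : 0 <= p <= 1 by rewrite p0.
have := lazy_mean_second_order (update k) p01 (enum {: edge n}) G pairs_connected_bound.
rewrite -cardE -/N big_enum /= sumrB sumr_const.
have /andP[S0 SM] := pairs_connected_bound G.
have := drift_pairs_connected hk sG.
rewrite -(ler_nat R) !natrD !natrM natr_sum -!/(S _) -/N.
set D := \sum_(e : edge n) _; set L := lazy_mean _ _ _ _ _.
have -> : n.-1%:R = n%:R - 1 :> R by rewrite -subn1 natrB // ltnW.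
have : 2 <= n%:R :> R by rewrite (ler_nat _ 2).
rewrite -mulr_natr -/(S G); move: (S G) S0 SM => s S0 SM.
move=> hn drift hL.
(* Here [n - 1 >= n / 2], by [n2]. *)
have : p * (D - s * N%:R) <= p * (7 * n%:R ^+ 2 - n%:R / 2 * s).
  by apply: ler_wpM2l => //; nra.
have : N%:R ^+ 2 * p * (p * n%:R ^+ 2) <= 2^-1 * (p * n%:R ^+ 2).
  by apply: ler_wpM2r; rewrite ?mulr_ge0 ?sqr_ge0 // mulrC.
move: hL; rewrite !expr2; nra.
Qed.

Lemma sweeps_pairs_connected r :
  lazy_mean (update k) p (flatten (nseq r (enum {: edge n}))) S (empty_graph n)
    <= 15 * n%:R.
Proof.
have p01 : 0 <= p <= 1 by rewrite p0.
set q := 1 - p * n%:R / 2; have q0 : 0 <= q.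
  by rewrite subr_ge0 ler_pdivrMr ?mul1r ?pn // ltr0n.
(* For the induction, the bound is a convex combination of the starting value and of the fixed point
   [15 n]; the empty graph starts at [n], below it. *)
suff H (G : multigraph n) : subcritical k G ->
    lazy_mean (update k) p (flatten (nseq r (enum {: edge n}))) S G <=
    q ^+ r * S G + (1 - q ^+ r) * (15 * n%:R).
  apply: le_trans (H _ (subcritical_empty n hk)) _; rewrite /S pairs_connected_empty.
  have : 0 <= q ^+ r * n%:R by rewrite mulr_ge0 ?exprn_ge0.
  by lra.
elim: r G => [|r IH] G sG; first by rewrite /= expr0; lra.
rewrite /= lazy_mean_cat.
have subE (y : multigraph n) e : subcritical k y -> subcritical k (update k y e).
  exact: subcritical_update.
apply: le_trans (le_lazy_mean p01 (enum {: edge n})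
  (h' := fun y => q ^+ r * S y + (1 - q ^+ r) * (15 * n%:R)) subE IH sG) _.
rewrite lazy_mean_affine exprSr.
have := sweep_pairs_connected sG; rewrite -/q => H.
have := ler_wpM2l (exprn_ge0 r q0) H; lra.
Qed.

End PairsMean.

(** * Reading the process off the slots *)

Section Slots.
Context {R : realType}.

(** Open on the left like the interval []0, t]] of [arrivals], which the slots of index below [r]
    partition. *)
Definition slot (t : R) (r j : nat) : set R :=
  `]t * (j%:R / r%:R), t * (j.+1%:R / r%:R)]%classic.

Lemma slotP (t : R) r j x :
  slot t r j x <-> t * (j%:R / r%:R) < x <= t * (j.+1%:R / r%:R).
Proof. by rewrite /slot /= in_itv. Qed.

Variables (t : R) (r : nat).
Hypotheses (t0 : 0 <= t) (r0 : (0 < r)%N).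

Lemma slot_endpoint_le i j : (i <= j)%N -> t * (i%:R / r%:R) <= t * (j%:R / r%:R).
Proof. by move=> ij; rewrite ler_wpM2l // ler_wpM2r ?invr_ge0 ?ler0n // ler_nat. Qed.

Lemma slot_lt i j x y : (i < j)%N -> slot t r i x -> slot t r j y -> x < y.
Proof.
move=> ij /slotP/andP[_ xi] /slotP/andP[yj _].
exact: le_lt_trans xi (le_lt_trans (slot_endpoint_le ij) yj).
Qed.

Lemma trivIset_slot : trivIset [set: 'I_r] (fun j => slot t r j).
Proof.
apply/trivIsetP => i j _ _; rewrite -val_eqE /= neq_ltn => ij.
apply/seteqP; split => // x [xi xj].
by case/orP: ij => ij; have := slot_lt ij; [move/(_ _ _ xi xj)|move/(_ _ _ xj xi)]; rewrite ltxx.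
Qed.

Lemma slot_bounds j x : (j < r)%N -> slot t r j x -> 0 < x <= t.
Proof.
move=> jr /slotP/andP[xl xu]; apply/andP; split.
  by apply: le_lt_trans xl; rewrite mulr_ge0 // divr_ge0 ?ler0n.
apply: le_trans xu (le_trans (slot_endpoint_le jr) _).
by rewrite divff ?mulr1 // pnatr_eq0 -lt0n.
Qed.

Lemma slot_cover x : 0 < x <= t -> exists j : 'I_r, slot t r j x.
Proof.
move=> /andP[x0 xt].
suff H m : (m <= r)%N -> x <= t * (m%:R / r%:R) -> exists j : 'I_r, slot t r j x.
  by apply: (H r) => //; rewrite divff ?mulr1 // pnatr_eq0 -lt0n.
elim: m => [|m IH] mr xm; first by move: xm; rewrite mul0r mulr0 leNgt x0.
have [xm'|xm'] := leP x (t * (m%:R / r%:R)); first exact: IH (ltnW mr) xm'.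
by exists (Ordinal mr); apply/slotP; rewrite xm' xm.
Qed.

Lemma slot_diff j x y : slot t r j x -> slot t r j y -> y - x < t / r%:R.
Proof.
move=> /slotP/andP[xl _] /slotP/andP[_ yu].
have -> : t / r%:R = t * (j.+1%:R / r%:R) - t * (j%:R / r%:R) by rewrite -natr1; ring.
by apply: ler_ltB.
Qed.

Lemma measurable_slot j : measurable (slot t r j).
Proof. exact: measurable_itv. Qed.

Lemma lebesgue_measure_slot j : lebesgue_measure (slot t r j) = (t / r%:R)%:E.
Proof.
rewrite /slot lebesgue_measure_itv /= lte_fin.
have -> : t / r%:R = t * (j.+1%:R / r%:R) - t * (j%:R / r%:R) by rewrite -natr1; ring.
case: ltP => // h; rewrite [X in _ = X%:E](_ : _ = 0) //.
by apply/eqP; rewrite eq_le subr_le0 h subr_ge0 slot_endpoint_le.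
Qed.

End Slots.

(** Once the slots are shorter than this gap, two points in one slot are simultaneous. *)
Lemma finite_set_gap (R : realType) (D : set R) : finite_set D ->
  exists2 g : R, 0 < g & forall x y, D x -> D y -> x < y -> g <= y - x.
Proof.
case/finite_seqP => s ->.
suff [g g0 gP] : exists2 g : R, 0 < g & forall z, z \in [seq y - x | x <- s, y <- s] -> 0 < z -> g <= z.
  exists g => // x y xs ys xy; apply: gP; last by rewrite subr_gt0.
  by apply/allpairsP; exists (x, y).
elim: [seq _ | _ <- _, _ <- _] => [|z l [g g0 gP]]; first by exists 1.
have [z0|z0] := ltP 0 z; last first.
  by exists g => // w; rewrite inE => /orP[/eqP ->|/gP //]; rewrite ltNge z0.
exists (Num.min z g); first by rewrite lt_min z0.
move=> w; rewrite inE => /orP[/eqP -> _|wl w0]; first by rewrite ge_min lexx.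
by rewrite ge_min (gP w) ?orbT.
Qed.

Lemma foldl_filter (S T : Type) (f : S -> T -> S) (a : pred T) (s : seq T) (z : S) :
  foldl f z (seq.filter a s) = foldl (fun y x => if a x then f y x else y) z s.
Proof. by elim: s z => //= x s IH z; case: ifP => _ /=; rewrite IH. Qed.

Lemma pairwise_allpairs (S T : eqType) (rS : rel S) (rT : rel T) (s : seq S) (u : seq T)
    (q : rel (S * T)) :
  (forall i j x y, rS i j -> q (i, x) (j, y)) ->
  (forall i x y, rT x y -> q (i, x) (i, y)) ->
  pairwise rS s -> pairwise rT u -> pairwise q [seq (i, x) | i <- s, x <- u].
Proof.
move=> qS qT + uu; elim: s => //= i s IH /andP[/allP si ss].
rewrite pairwise_cat IH // andbT; apply/andP; split; last first.
  by rewrite pairwise_map; apply: sub_pairwise uu => x y; exact: qT.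
apply/allrelP => _ _ /mapP[x _ ->] /allpairsP[[j y] [/= js _ ->]].
exact/qS/si.
Qed.

Lemma pairwise_enum_rank (T : finType) :
  pairwise (fun x y : T => enum_rank x < enum_rank y)%N (enum T).
Proof.
case E: (enum T) => [//|x0 s]; rewrite -E.
have rankE i : (i < size (enum T))%N -> enum_rank (nth x0 (enum T) i) = i :> nat.
  move=> i_lt; apply/eqP; rewrite -(nth_uniq x0 _ i_lt (enum_uniq T)) ?nth_enum_rank //.
  by rewrite -cardE.
by apply/(pairwiseP x0) => i j i_lt j_lt ij; rewrite !rankE.
Qed.

Section Arrivals.
Context {R : realType}.
Variables (n : nat) (pi : edge n -> set R) (t : R).
Hypotheses (t0 : 0 <= t) (pi_fin : forall e, finite_set (pi e `&` `[0, t])).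

Lemma earlier_total : total (@earlier R n).
Proof.
move=> x y; rewrite /earlier; case: (ltgtP x.1 y.1) => //= _.
exact: leq_total.
Qed.

Lemma earlier_trans : transitive (@earlier R n).
Proof.
move=> y x z; rewrite /earlier => /orP[xy|/andP[/eqP xy xy2]] /orP[yz|/andP[/eqP yz yz2]].
- by rewrite (lt_trans xy yz).
- by rewrite -yz xy.
- by rewrite xy yz.
- by rewrite xy yz eqxx (leq_trans xy2 yz2) orbT.
Qed.

Lemma earlier_anti : antisymmetric (@earlier R n).
Proof.
move=> [x e] [y f]; rewrite /earlier /=; case: (ltgtP x y) => //= -> ef.
by congr (_, _); apply/enum_rank_inj/val_inj/anti_leq.
Qed.

Lemma finite_arrivals : finite_set [set x : R * edge n | 0 < x.1 <= t /\ pi x.2 x.1].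
Proof.
apply: (@sub_finite_set _ _ (\bigcup_(e in [set: edge n]) ((pi e `&` `[0, t]) `*` [set e]))).
  move=> [x e] /= [/andP[x0 xt] ex]; exists e => //; split => //=; split => //.
  by rewrite in_itv /= xt ltW.
by apply: bigcup_finite => [|e _]; [exact: finite_finset|exact: finite_setX].
Qed.

Definition hit (r : nat) (i : 'I_r * edge n) : bool :=
  `[< pi i.2 `&` slot t r i.1 !=set0 >].

(** Every slot runs through all edges once: these are the [r] sweeps of the mean, with the slot
    index attached. *)
Definition slot_edges (r : nat) : seq ('I_r * edge n) :=
  [seq (j, e) | j <- enum 'I_r, e <- enum {: edge n}].

(** Points in one slot may belong to several edges but are simultaneous, and [earlier] breaks ties
    in the order in which a slot lists the edges. The arrivals and the hit pairs are thus two sorted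
    lists with the same elements. *)
Lemma process_slot_edges k r : (0 < r)%N ->
  (forall (j : 'I_r) e f x y, slot t r j x -> slot t r j y -> pi e x -> pi f y -> x = y) ->
  forbidden_degree_process k pi t =
  foldl (fun G i => if hit i then update k G i.2 else G) (empty_graph n) (slot_edges r).
Proof.
move=> r0 sep.
(* When [hit i] holds this is, by [sep], the only point of the edge in the slot; the default 0 is
   never read. *)
pose time (i : 'I_r * edge n) := xget 0 (pi i.2 `&` slot t r i.1).
have timeP i : hit i -> pi i.2 (time i) /\ slot t r i.1 (time i).
  by move=> /asboolP[x xi]; have := @xgetPex _ 0 _ (ex_intro _ _ xi).
pose L := [seq (time i, i.2) | i <- slot_edges r & hit i].
pose q (i j : 'I_r * edge n) := (i.1 < j.1)%N || ((i.1 == j.1) && (enum_rank i.2 < enum_rank j.2)%N).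
have q_slots : pairwise q (slot_edges r).
  apply: (@pairwise_allpairs _ _ (fun i j : 'I_r => (i < j)%N) (fun e f : edge n => (enum_rank e < enum_rank f)%N)).
  - by move=> i j x y ij; rewrite /q /= ij.
  - by move=> i x y xy; rewrite /q /= eqxx xy orbT.
  - rewrite -(@pairwise_map _ _ (val : 'I_r -> nat) ltn) val_enum_ord.
    by rewrite -sorted_pairwise; [exact: iota_ltn_sorted|exact: ltn_trans].
  - exact: pairwise_enum_rank.
have q_hit : pairwise q [seq i <- slot_edges r | hit i] by exact: pairwise_filter.
have sL : sorted (@earlier R n) L.
  apply/pairwise_sorted; rewrite pairwise_map.
  apply: sub_in_pairwise (filter_all _ _) q_hit => i j hi hj.
  have [pi_i si] := timeP i hi; have [pi_j sj] := timeP j hj.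
  rewrite /q /earlier /= => /orP[ij|/andP[/eqP ij ef]]; first by rewrite (slot_lt t0 ij si sj).
  rewrite ij in si; rewrite (sep _ _ _ _ _ si sj pi_i pi_j) eqxx (ltnW ef) orbT //.
have uL : uniq L.
  rewrite map_inj_in_uniq; first by apply: pairwise_uniq q_hit => i; rewrite /q !ltnn andbF.
  move=> [i e] [j f]; rewrite !mem_filter => /andP[hi _] /andP[hj _] /= [tij ef].
  have [_ /= si] := timeP _ hi; have [_ /= sj] := timeP _ hj; rewrite -tij in sj.
  congr (_, _) => //; apply/eqP; rewrite -val_eqE /=; apply/negPn/negP; rewrite neq_ltn.
  by case/orP => ij; [have := slot_lt t0 ij si sj|have := slot_lt t0 ij sj si]; rewrite ltxx.
have -> : forbidden_degree_process k pi t = foldl (fun G (x : R * edge n) => update k G x.2) (empty_graph n) L.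
  rewrite /forbidden_degree_process; congr foldl.
  apply: (sorted_eq earlier_trans earlier_anti) (sort_sorted earlier_total _) sL _.
  rewrite perm_sort; apply: uniq_perm; [exact: fset_uniq|exact: uL|move=> x].
  rewrite in_fset_set ?inE; last exact: finite_arrivals.
  apply/asboolP/mapP => [[xt px]|[i]].
    have [j jx] := slot_cover r0 xt.
    have hjx : hit (j, x.2) by apply/asboolP; exists x.1.
    exists (j, x.2).
      by rewrite mem_filter hjx; apply/allpairsP; exists (j, x.2); rewrite !mem_enum.
    have [/= pj sj] := timeP _ hjx.
    by rewrite (surjective_pairing x) /= (sep _ _ _ _ _ jx sj px pj).
  rewrite mem_filter => /andP[hi _] ->; have [pj sj] := timeP _ hi.
  by split => //; exact: slot_bounds sj.
rewrite -(foldl_filter (fun G (i : 'I_r * edge n) => update k G i.2)).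
by rewrite /L; elim: [seq i <- _ | _] (empty_graph n) => //= i s IH G; rewrite IH.
Qed.

End Arrivals.

(** * Poisson points in the slots *)

Section FoldEvents.
Context {R : realType} {d : measure_display} {T : measurableType d}.
Variables (P : probability T R) (I : finType) (A : I -> set T) (q : R).
Hypothesis mA : forall i, measurable (A i).
Hypothesis PA : forall K : {set I}, P (\bigcap_(i in [set` K]) ~` A i) = (q ^+ #|K|)%:E.
Variables (S : Type) (act : S -> I -> S) (bad : pred S).

Definition fold_event (s : seq I) (x : S) : set T :=
  [set w | bad (foldl (fun y i => if `[< A i w >] then act y i else y) x s)].

Lemma fold_event_nil x : fold_event [::] x = if bad x then setT else set0.
Proof. by apply/seteqP; split=> w; rewrite /fold_event /=; case: (bad x). Qed.

Lemma fold_event_cons i s x : fold_event (i :: s) x =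
  (fold_event s (act x i) `&` A i) `|` (fold_event s x `\` A i).
Proof.
apply/seteqP; split=> w; rewrite /fold_event /=; case: asboolP => Ai.
- by left.
- by right.
- by case=> -[].
- by case=> -[].
Qed.

Lemma measurable_fold_event s x : measurable (fold_event s x).
Proof.
elim: s x => [|i s IH] x.
  by rewrite fold_event_nil; case: ifP => _; [exact: measurableT|exact: measurable0].
by rewrite fold_event_cons; apply: measurableU; [exact: measurableI|exact: measurableD].
Qed.

(* The induction only needs the joint probabilities of the events [~` A i]:
   [P (B `&` A i) = P B - P (B `\` A i)]. *)
Lemma prob_misses_fold_event s x (K : {set I}) : uniq s -> (forall i, i \in s -> i \notin K) ->
  P ((\bigcap_(i in [set` K]) ~` A i) `&` fold_event s x) =
  (q ^+ #|K| * lazy_mean act (1 - q) s (fun y => (bad y)%:R) x)%:E.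
Proof.
elim: s x K => [|i s IH] x K /=.
  move=> _ _; rewrite fold_event_nil; case: (bad x); first by rewrite setIT PA mulr1.
  by rewrite setI0 measure0 mulr0.
case/andP=> is_ us sK.
have iK : i \notin K by apply: sK; rewrite mem_head.
have sK' j : j \in s -> j \notin K by move=> js; apply: sK; rewrite inE js orbT.
have sK'' j : j \in s -> j \notin (i |: K).
  move=> js; rewrite !inE negb_or sK' // andbT.
  by apply: contraNneq is_ => <-.
set Z := \bigcap_(j in [set` K]) ~` A j.
have mZ : measurable Z.
  by apply: fin_bigcap_measurable => [|j _]; [exact: finite_finset|exact: measurableC].
have ZE : \bigcap_(j in [set` i |: K]) ~` A j = Z `\` A i.
  apply/seteqP; split => w.
    move=> h; split; last by apply: h; rewrite /= setU11.
    by move=> j jK; apply: h; rewrite /= !inE; apply/orP; right.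
  by case=> wZ wA j; rewrite /= !inE => /orP[/eqP ->|jK] //; exact: wZ.
have mF := measurable_fold_event.
have miss y : P (Z `&` fold_event s y `\` A i) =
    (q ^+ #|K|.+1 * lazy_mean act (1 - q) s (fun y => (bad y)%:R) y)%:E.
  have := IH y _ us sK''; rewrite ZE cardsU1 iK => <-; congr (P _).
  by apply/seteqP; split => w [[? ?] ?]; split => //; split.
have IHK y := IH y K us sK'; rewrite -/Z in IHK.
have hit_i y : P (Z `&` fold_event s y `&` A i) =
    (q ^+ #|K| * (1 - q) * lazy_mean act (1 - q) s (fun y => (bad y)%:R) y)%:E.
  have : P (Z `&` fold_event s y) =
      (P (Z `&` fold_event s y `\` A i) + P (Z `&` fold_event s y `&` A i))%E.
    exact: measureDI (measurableI _ _ mZ (mF s y)) (mA i).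
  rewrite IHK miss.
  set X := P _; have Xfin : X \is a fin_num.
    by apply: fin_num_measure; apply: measurableI => //; apply: measurableI.
  rewrite -(fineK Xfin) -EFinD => -[hX]; congr (_%:E).
  by move: hX; rewrite exprS; lra.
have -> : P (Z `&` fold_event (i :: s) x) =
    (P (Z `&` fold_event s (act x i) `&` A i) + P (Z `&` fold_event s x `\` A i))%E.
  rewrite fold_event_cons setIUr setIA setIDA; apply: measureU.
  - by apply: measurableI => //; apply: measurableI.
  - by apply: measurableD => //; apply: measurableI.
  - by apply/seteqP; split => // w [[_ ?] []].
by rewrite hit_i miss -EFinD exprS; congr (_%:E); ring.
Qed.

Lemma prob_fold_event s x : uniq s ->
  P (fold_event s x) = (lazy_mean act (1 - q) s (fun y => (bad y)%:R) x)%:E.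
Proof.
move=> us; have := prob_misses_fold_event (K := finset.set0) x us.
rewrite cards0 expr0 mul1r => <- => [|i _]; last by rewrite inE.
congr (P _); apply/seteqP; split => [w ?|w [] //]; split => // i /=.
by rewrite inE.
Qed.

End FoldEvents.

Section Poisson.
Context {R : realType} {d : measure_display} {T : measurableType d}.
Variables (P : probability T R) (n : nat) (Pi : edge n -> T -> set R) (lambda : R).
Hypothesis hPoisson : forall e, poisson_point_process P lambda (Pi e).
Hypothesis hindep : mutually_independent P (fun e => sigma_of (Pi e)).
Variables (t : R) (r : nat).
Hypotheses (t0 : 0 <= t) (r0 : (0 < r)%N).

Definition hit_event (i : 'I_r * edge n) : set T :=
  [set w | Pi i.2 w `&` slot t r i.1 !=set0].

Lemma count_event0 (X : T -> set R) (B : set R) :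
  count_event X B 0 = [set w | X w `&` B = set0].
Proof.
by apply/seteqP; split => w /=; rewrite /count_event /= II0 card_eq0 => /eqP.
Qed.

Lemma hit_eventC i : ~` hit_event i = count_event (Pi i.2) (slot t r i.1) 0.
Proof.
rewrite count_event0; apply/seteqP; split => w /=.
  by move=> h; apply: contrapT => /eqP/set0P.
by move=> h [x]; rewrite h.
Qed.

Lemma measurable_hit_event i : measurable (hit_event i).
Proof.
rewrite -[hit_event i]setCK hit_eventC; apply: measurableC.
have [[_ _ mX] _ _] := hPoisson i.2.
by apply: mX; exact: measurable_slot.
Qed.

(** Independence is used twice: between edges, then for one edge between disjoint slots, each missed
    with the Poisson weight of 0. *)
Lemma prob_hit_eventC (K : {set 'I_r * edge n}) :
  P (\bigcap_(i in [set` K]) ~` hit_event i) = (expR (- (lambda * (t / r%:R))) ^+ #|K|)%:E.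
Proof.
pose Ke (e : edge n) : {set 'I_r} := [set j | (j, e) \in K]%SET.
pose D e := \bigcap_(j in [set` Ke e]) count_event (Pi e) (slot t r j) 0.
have -> : \bigcap_(i in [set` K]) ~` hit_event i = \bigcap_(e in [set` [set: edge n]%SET]) D e.
  apply/seteqP; split => w h.
    move=> e _ j /=; rewrite inE => jeK.
    by have := h (j, e) jeK; rewrite hit_eventC.
  move=> [j e] jeK; rewrite hit_eventC; apply: h => //=; rewrite inE //.
have slot_pos j : (j < r)%N -> slot t r j `<=` `[0, +oo[.
  move=> jr x jx; have /andP[x0 _] := slot_bounds t0 r0 jr jx.
  by rewrite /= in_itv /= ltW.
(* To belong to [sigma_of (Pi e)], the event of missing several slots is written as a single count
   event: no point in their union. *)
rewrite hindep => [|e _]; last first.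
  apply: sub_sigma_algebra; exists (\bigcup_(j in [set` Ke e]) slot t r j), 0%N; split.
    by apply: fin_bigcup_measurable => [|j _]; [exact: finite_finset|exact: measurable_slot].
  rewrite count_event0; apply/seteqP; split => w.
    move=> h; apply/seteqP; split => // x [px [j jK jx]].
    by have := h j jK; rewrite count_event0 => /seteqP[] /(_ x (conj px jx)).
  move=> h j jK; rewrite count_event0; apply/seteqP; split => // x [px jx].
  by have /seteqP[h1 _] := h; apply: (h1 x); split => //; exists j.
have PD e : P (D e) = (expR (- (lambda * (t / r%:R))) ^+ #|Ke e|)%:E.
  have [_ Pcount Pindep] := hPoisson e.
  rewrite /D (Pindep r (fun j => slot t r j)).
  - rewrite (eq_bigr (fun=> (expR (- (lambda * (t / r%:R))))%:E)) => [|j _].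
      by rewrite prodEFin prodr_const.
    rewrite Pcount ?lebesgue_measure_slot ?ltry //; last 2 first.
    - exact: measurable_slot.
    - exact: slot_pos.
    by rewrite /poisson_weight expr0 mulr1 fact0 divr1.
  - by move=> j; exact: measurable_slot.
  - by move=> j; exact: slot_pos.
  - by move=> j; rewrite lebesgue_measure_slot ?ltry.
  - exact: trivIset_slot.
  - by move=> j _; exists 0%N.
under eq_bigr do rewrite PD.
rewrite prodEFin; congr (_%:E).
rewrite prodrXr; congr (_ ^+ _).
rewrite -sum1_card (eq_bigl (fun i => (i.1, i.2) \in K)); last by case.
rewrite (eq_bigl xpredT); last by move=> e; rewrite inE.
under eq_bigr do rewrite -sum1_card.
rewrite (exchange_big_dep xpredT) //= pair_big_dep /=.
by apply: eq_bigl => -[j e]; rewrite inE.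
Qed.

End Poisson.

(** * Passing to the limit *)

(** The rank from which [B] and [F r] agree depends on [w]. Still, [B] is the increasing union of
    the events that [F r] holds for all [r >= m], each of probability at most [b]; this also makes
    [B] measurable. *)
Lemma prob_eventually_eq_le (R : realType) (d : measure_display) (T : measurableType d)
    (P : probability T R) (F : nat -> set T) (B : set T) (b : \bar R) :
  (forall r, measurable (F r)) ->
  (forall w, exists m, forall r, (m <= r)%N -> (B w <-> F r w)) ->
  (exists m, forall r, (m <= r)%N -> (P (F r) <= b)%E) -> (P B <= b)%E.
Proof.
move=> mF BF [m0 Pb].
pose C m := \bigcap_(r in [set r | (m <= r)%N]) F r.
have mC m : measurable (C m).
  by apply: bigcap_measurable => //; exists m => /=.
have BE : B = \bigcup_m C m.
  apply/seteqP; split => w.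
    by move=> Bw; have [m Fm] := BF w; exists m => // r /Fm <-.
  case=> m _ Cw; have [m' Fm'] := BF w.
  by apply/(Fm' _ (leq_maxr m m'))/Cw; rewrite /= leq_maxl.
have cvC : (P \o C) x @[x --> \oo] --> P (\bigcup_m C m).
  apply: nondecreasing_cvg_mu => //; first exact: bigcup_measurable.
  move=> m m' mm'; apply/subsetPset => w Cw r /= mr; apply: Cw => /=.
  exact: leq_trans mr.
rewrite BE; apply: cvge_le cvC; near=> m; rewrite /=.
apply: le_trans (Pb (maxn m m0) (leq_maxr _ _)).
by apply: le_measure; rewrite ?inE // => w; apply; rewrite /= leq_maxl.
Unshelve. all: by end_near.
Qed.

Section Discretization.
Context {R : realType}.
Variables (n k : nat) (t : R).
Hypothesis t0 : 0 <= t.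

Lemma uniq_slot_edges r : uniq (slot_edges n r).
Proof.
apply: allpairs_uniq; [exact: enum_uniq|exact: enum_uniq|].
by move=> [? ?] [? ?] _ _ [-> ->].
Qed.

Lemma lazy_mean_slot_edges (p : R) r h (G : multigraph n) :
  lazy_mean (fun G (i : 'I_r * edge n) => update k G i.2) p (slot_edges n r) h G =
  lazy_mean (update k) p (flatten (nseq r (enum {: edge n}))) h G.
Proof.
have -> : flatten (nseq r (enum {: edge n})) = map snd (slot_edges n r).
  rewrite /slot_edges -[in LHS](size_enum_ord r); elim: (enum 'I_r) => //= j s ->.
  by rewrite map_cat -map_comp map_id.
by elim: (slot_edges n r) G => //= i s IH G; rewrite !IH.
Qed.

Lemma process_eventually (pi : edge n -> set R) :
  (forall e, finite_set (pi e `&` `[0, t])) ->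
  exists m, forall r, (m <= r)%N ->
    forbidden_degree_process k pi t =
    foldl (fun G i => if hit pi t i then update k G i.2 else G) (empty_graph n)
      (slot_edges n r.+1).
Proof.
move=> pi_fin.
have /finite_set_gap[g g0 gap] : finite_set (\bigcup_(e in [set: edge n]) (pi e `&` `[0, t])).
  by apply: bigcup_finite => //; exact: finite_finset.
(* From this rank on, the slot length [t / r.+1] is below the gap [g]. *)
exists (Num.bound (t / g)) => r mr; apply: process_slot_edges => // j e f x y jx jy px py.
have small : t / r.+1%:R < g.
  rewrite ltr_pdivrMr ?ltr0n // mulrC -ltr_pdivrMr //.
  apply: lt_le_trans (archi_boundP _) _; first by rewrite divr_ge0 // ltW.
  by rewrite ler_nat (leq_trans mr).
have D z h : slot t r.+1 j z -> pi h z -> (\bigcup_(e in [set: edge n]) (pi e `&` `[0, t])) z.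
  move=> jz hz; exists h => //; split => //.
  by have /andP[z0 zt] := slot_bounds t0 (ltn0Sn r) (ltn_ord j) jz; rewrite /= in_itv /= ltW.
have Dx := D _ _ jx px; have Dy := D _ _ jy py.
case: (ltgtP x y) => // xy; exfalso.
  by have := le_lt_trans (gap _ _ Dx Dy xy) (lt_trans (slot_diff jx jy) small); rewrite ltxx.
by have := le_lt_trans (gap _ _ Dy Dx xy) (lt_trans (slot_diff jy jx) small); rewrite ltxx.
Qed.

Hypotheses (n2 : (2 <= n)%N) (hk : (0 < k <= 3)%N).

Lemma eventually_pairs_mean : exists m, forall r, (m <= r)%N ->
  let p := 1 - expR (- (n%:R^-1 * (t / r.+1%:R))) in
  0 <= p <= 1 /\
  lazy_mean (update k) p (flatten (nseq r.+1 (enum {: edge n})))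
    (fun G => (pairs_connected G)%:R) (empty_graph n) <= 15 * n%:R.
Proof.
set N : R := #|{: edge n}|%:R.
(* This rank gives [(t / r.+1) * (1 + N ^+ 2) <= 1/2]. As [p <= t / (n r.+1)], the term 1 serves the
   condition on [p n] and [N ^+ 2] the one on [p N^2]. *)
exists (Num.bound (2 * t * (1 + N ^+ 2))) => r mr p.
have n0 : 1 <= n%:R :> R by rewrite (ler_nat _ 1) ltnW.
have x0 : 0 <= t / r.+1%:R by rewrite divr_ge0.
have ni0 : 0 < n%:R^-1 :> R by rewrite invr_gt0; lra.
have ni1 : n%:R^-1 <= 1 :> R by rewrite invf_le1 //; lra.
have p0 : 0 <= p.
  by rewrite subr_ge0 -[leRHS]expR0 ler_expR oppr_le0 mulr_ge0 // ltW.
have p1 : p <= 1 by rewrite gerBl expR_ge0.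
have px : p <= n%:R^-1 * (t / r.+1%:R).
  by rewrite /p lerBlDl -lerBlDr expR_ge1Dx.
have small : (t / r.+1%:R) * (1 + N ^+ 2) <= 2^-1.
  rewrite mulrAC ler_pdivrMr ?ltr0n // ler_pdivlMl // mulrA.
  apply/ltW; apply: lt_le_trans (archi_boundP _) _.
    by rewrite !mulr_ge0 // addr_ge0 ?sqr_ge0.
  by rewrite ler_nat (leq_trans mr).
have N0 : 0 <= N ^+ 2 by rewrite sqr_ge0.
split; first by rewrite p0 p1.
have hx : t / r.+1%:R <= 2^-1.
  by apply: le_trans small; rewrite ler_peMr // lerDl.
have hxN : t / r.+1%:R * N ^+ 2 <= 2^-1.
  by apply: le_trans small; rewrite ler_wpM2l // lerDr.
apply: sweeps_pairs_connected => //.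
- rewrite -ler_pdivlMr; last by lra.
  by rewrite mulrC; apply: le_trans px _; rewrite ler_pM2l // (le_trans hx) //; lra.
- apply: le_trans hxN; apply: ler_wpM2r => //; apply: le_trans px _.
  by rewrite ler_piMl.
Qed.

End Discretization.

Section Bound.
Context {R : realType} {d : measure_display} {T : measurableType d}.
Variables (P : probability T R) (n k : nat) (Pi : edge n -> T -> set R) (t : R).
Hypothesis hPoisson : forall e, poisson_point_process P n%:R^-1 (Pi e).
Hypothesis hindep : mutually_independent P (fun e => sigma_of (Pi e)).
Hypotheses (t0 : 0 <= t) (n2 : (2 <= n)%N) (hk : (0 < k <= 3)%N).

Lemma prob_Cmax_ge (eps : R) : 0 < eps ->
  (P [set w | (eps <= `|(Cmax (forbidden_degree_process k (fun e => Pi e w) t))%:R / n%:R - 0|)%R]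
    <= (15 / (eps ^+ 2 * n%:R))%:E)%E.
Proof.
move=> eps0.
pose bad (G : multigraph n) := eps <= `|(Cmax G)%:R / n%:R - 0|.
pose act r (G : multigraph n) (i : 'I_r * edge n) := update k G i.2.
pose F r := fold_event (hit_event Pi t (r := r.+1)) (@act r.+1) bad (slot_edges n r.+1) (empty_graph n).
have n0 : 0 < n%:R :> R by rewrite ltr0n ltnW.
apply: (@prob_eventually_eq_le _ _ _ _ F).
- by move=> r; apply: measurable_fold_event => i; exact: measurable_hit_event.
- move=> w; have [] := @process_eventually R n k t t0 (fun e => Pi e w).
    by move=> e; have [[_ fin _] _ _] := hPoisson e.
  by move=> m Fm; exists m => r /Fm /= ->.
have [m hm] := eventually_pairs_mean t0 n2 hk.
exists m => r /hm[p01 le15].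
rewrite /F (prob_fold_event (q := expR (- (n%:R^-1 * (t / r.+1%:R))))).
- rewrite lee_fin lazy_mean_slot_edges.
  (* Markov's factor: [Cmax G >= eps n] forces [pairs_connected G >= (eps n)^2], so the indicator of
     [bad] is at most [c * pairs_connected G]. *)
  pose c : R := (eps * n%:R) ^- 2.
  have c0 : 0 <= c by rewrite invr_ge0 sqr_ge0.
  apply: (@le_trans _ _ (c * (15 * n%:R))); last first.
    by rewrite /c le_eqVlt; apply/orP; left; apply/eqP; field; rewrite !gt_eqF.
  apply: (@le_trans _ _ (lazy_mean (update k) (1 - expR (- (n%:R^-1 * (t / r.+1%:R))))
    (flatten (nseq r.+1 (enum {: edge n}))) (fun G => c * (pairs_connected G)%:R + 0) (empty_graph n))).
    apply: (@le_lazy_mean _ _ _ _ _ p01 xpredT) => // G _; rewrite addr0.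
    have [|_] := boolP (bad G); last by rewrite mulr_ge0.
    rewrite /bad subr0 ger0_norm ?divr_ge0 // ler_pdivlMr // => epsG.
    rewrite /c mulrC ler_pdivlMr ?exprn_gt0 ?mulr_gt0 // mul1r.
    apply: (@le_trans _ _ ((Cmax G)%:R ^+ 2)).
      by rewrite ler_sqr ?nnegrE ?ler0n // mulr_ge0 ?ler0n // ltW.
    by rewrite -natrX ler_nat; exact: Cmax_sqr_le.
  by rewrite lazy_mean_affine addr0; exact: ler_wpM2l.
- by move=> i; exact: measurable_hit_event.
- by move=> K; exact: prob_hit_eventC.
- exact: uniq_slot_edges.
Qed.

End Bound.

Theorem theorem1p1 (R : realType) (k : nat) (hk : (0 < k <= 3)%N)
    (t : nat -> R) (ht : forall n : nat, 0 <= t n)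
    (d : nat -> measure_display)
    (T : forall n : nat, measurableType (d n))
    (P : forall n : nat, probability (T n) R)
    (Pi : forall n : nat, edge n -> T n -> set R)
    (hPoisson : forall (n : nat) (e : edge n), (0 < n)%N ->
       poisson_point_process (P n) n%:R^-1 (Pi n e))
    (hindep : forall n : nat, (0 < n)%N ->
       mutually_independent (P n) (fun e : edge n => sigma_of (Pi n e))) :
  cvg_in_probability P
    (fun (n : nat) (w : T n) =>
       (Cmax (forbidden_degree_process k (fun e => Pi n e w) (t n)))%:R / n%:R)
    0.
Proof.
move=> eps eps0.
(* [harmonic n] is [1 / (n + 1)], and [n + 1 <= 2 n] turns the 15 of [prob_Cmax_ge] into 30. *)
have bound_cvg : (fun n => (30 / eps ^+ 2 * harmonic n : R)%:E) @ \oo --> 0%E.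
  apply: cvg_EFin; first by near=> n.
  rewrite -[X in _ --> X](mulr0 (30 / eps ^+ 2)).
  by apply: cvgMr; exact: cvg_harmonic.
apply: squeeze_cvge (cvg_cst 0%E) bound_cvg; near=> n.
have n2 : (2 <= n)%N by near: n; exists 2%N.
have n0 : (0 < n)%N by exact: ltnW.
rewrite measure_ge0 /=.
apply: le_trans (prob_Cmax_ge (fun e => hPoisson n e n0) (hindep n n0) (ht n) n2 hk eps0) _.
rewrite lee_fin invfM mulrA /=.
have -> : 30 / eps ^+ 2 * n.+1%:R^-1 = 15 / eps ^+ 2 * (2 / n.+1%:R) :> R by ring.
rewrite ler_pM2l ?divr_gt0 ?exprn_gt0 //.
rewrite -[leLHS]mul1r ler_pdivrMr ?ltr0n // mulrAC ler_pdivlMr ?ltr0n // mul1r.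
by rewrite -natrM ler_nat; lia.
Unshelve. all: by end_near.
Qed.
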